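(* There does not exist any orthomorphism polynomial of degree $7$ over $\mathbb{F}_{23}$, and there does not exist any orthomorphism polynomial of degree $7$ over $\mathbb{F}_{31}$.
   Context: A polynomial $f\in\mathbb{F}_q[x]$ is a permutation polynomial (PP) over $\mathbb{F}_q$ if $c\mapsto f(c)$ is a bijection of $\mathbb{F}_q$; it is an orthomorphism polynomial over $\mathbb{F}_q$ if both $f(x)$ and $f(x)-x$ are PPs over $\mathbb{F}_q$. *)

(* Defs.v *)
From mathcomp Require Import all_boot all_order all_algebra.

Set Implicit Arguments.
Unset Strict Implicit.
Unset Printing Implicit Defensive.

Import GRing.Theory.
Local Open Scope ring_scope.

Definition permutation_poly (F : finFieldType) (f : {poly F}) : Prop :=
  bijective (fun c : F => f.[c]).

Definition orthomorphism_poly (F : finFieldType) (f : {poly F}) : Prop :=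
  permutation_poly f /\ permutation_poly (f - 'X).

(* Main.v *)
Require Import Defs.
From Stdlib Require Import NArith.
From mathcomp Require Import all_boot all_order all_algebra.
From mathcomp Require Import finfield ring.

Set Implicit Arguments.
Unset Strict Implicit.
Unset Printing Implicit Defensive.

Import GRing.Theory.
Local Open Scope ring_scope.

(* By Hermite's criterion, [p ^+ k] has zero coefficient at X^(q-1) whenever p
   permutes F_q, 0 < k < q - 1 and deg (p ^+ k) < 2 (q - 1).
   For q = 23, f^4 - (f - X)^4 has coefficient 4 a^3 <> 0 at X^22, where a is
   the leading coefficient of f.
   For q = 31, an affine change of variables turns f and f - X into p and
   p - b X with b <> 0, p = X^7 + a5 X^5 + ... + a0 and a5 in {0, 1, 3}, because
   3 is not a square.  The coefficient of p^5 at X^30 determines a2, and that of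
   p^6 - (p - b X)^6 determines a1 - b / 2.  Hence, up to a0, p and p - b X are
   h + e X and h - e X where e = b / 2 and h depends on a5, a4, a3 only; for each
   (a5, a4, a3, e) a computation finds a collision of values of one of them. *)

(** * Power sums over a finite field and Hermite's criterion *)

(** Multiplication by a unit $a$ permutes the field and scales the sum by $a^k$; a nonzero sum would
    make all $q-1$ units roots of $X^k-1$. *)
Lemma sum_expf_eq0 (F : finFieldType) (k : nat) :
  (0 < k < #|F|.-1)%N -> \sum_(c : F) c ^+ k = 0.
Proof.
move=> /andP[k_gt0 k_lt]; apply/eqP/negPn/negP => S_neq0.
have unity (a : F) : a != 0 -> a ^+ k = 1.
  move=> a_neq0; apply: (mulIf S_neq0); rewrite mul1r mulr_sumr.
  rewrite [RHS](reindex_inj (mulfI a_neq0)).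
  by apply: eq_bigr => c _; rewrite exprMn.
suff : (#|[pred a : F | a != 0%R]| <= k)%N by rewrite cardC1 leqNgt k_lt.
rewrite cardE; apply: max_unity_roots (enum_uniq _) => //.
by apply/allP => a; rewrite mem_enum inE unity_rootE => /unity ->.
Qed.

(** Translation by 1 permutes the field, yet adds $q$ to the sum of its elements. *)
Lemma natr_card_eq0 (F : finFieldType) : #|F|%:R = 0 :> F.
Proof.
have : \sum_(c : F) c = \sum_(c : F) (c + 1).
  by rewrite [LHS](reindex_inj (addIr 1)).
by rewrite big_split /= sumr_const -[LHS]addr0 => /addrI.
Qed.

Lemma sum_expf_card_pred (F : finFieldType) :
  \sum_(c : F) c ^+ #|F|.-1 = -1.
Proof.
have card_gt1 := finNzRing_gt1 F.
have m_gt0 : (0 < #|F|.-1)%N by rewrite -subn1 subn_gt0.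
rewrite (bigD1 0) //= expr0n eqn0Ngt m_gt0 add0r.
rewrite (eq_bigr (fun=> 1)) => [|c c_neq0].
  rewrite sumr_const cardC1 -subn1 natrB ?(ltnW card_gt1) //.
  by rewrite natr_card_eq0 sub0r.
apply: (mulfI c_neq0).
by rewrite -exprS (ltn_predK card_gt1) expf_card mulr1.
Qed.

(** Below $2(q-1)$ the only positive multiple of $q-1$ is $q-1$ itself, so every other positive
    exponent has power sum 0; exponent 0 gives $q = 0$. *)
Lemma sum_horner (F : finFieldType) (p : {poly F}) :
  (size p <= (#|F|.-1).*2)%N -> \sum_(c : F) p.[c] = - p`_(#|F|.-1).
Proof.
set m := #|F|.-1 => szp; have card_gt1 := finNzRing_gt1 F.
have m_gt0 : (0 < m)%N by rewrite /m -subn1 subn_gt0.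
under eq_bigr do rewrite (horner_coef_wide _ szp).
rewrite exchange_big /=; under eq_bigr do rewrite -mulr_sumr.
have lt_m : (m < m.*2)%N by rewrite -addnn -ltn_subLR ?subnn.
rewrite (bigD1 (Ordinal lt_m)) //= sum_expf_card_pred mulrN1.
rewrite big1 ?addr0 // => i; rewrite -val_eqE /= => i_neq.
have [->|i_gt0] := posnP i.
  under eq_bigr do rewrite expr0.
  by rewrite sumr_const natr_card_eq0 mulr0.
have [i_lt|i_ge] := ltnP i m; first by rewrite sum_expf_eq0 ?mulr0 ?i_gt0.
have i_gt : (m < i)%N by rewrite ltn_neqAle eq_sym i_neq.
(* As $i > m$, the identity $c^q = c$ lowers the exponent by $m$ for every $c$, zero included, and
   $0 < i-m < m$. *)
rewrite (eq_bigr (fun c => c ^+ (i - m))) => [|c _].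
  rewrite sum_expf_eq0 ?mulr0 // subn_gt0 i_gt /= -/m ltn_subLR //.
  by rewrite addnn ltn_ord.
have {1}-> : nat_of_ord i = (i - m.+1 + #|F|)%N.
  by rewrite -(ltn_predK card_gt1) -/m addnS -addSn subnSK // subnK.
by rewrite exprD expf_card -exprSr subnSK.
Qed.

(** The values of [p] run once through the field, so the sum of the values of [p ^+ k] is the
    vanishing power sum of exponent [k]. *)
Lemma permutation_poly_coef_expr (F : finFieldType) (p : {poly F}) (k m : nat) :
    #|F| = m.+1 -> permutation_poly p -> (0 < k < m)%N ->
  (size (p ^+ k) <= m.*2)%N -> (p ^+ k)`_m = 0.
Proof.
move=> /(congr1 predn)/= <- perm_p k_bnd szpk.
apply/oppr_inj; rewrite oppr0 -sum_horner //.
rewrite -[RHS](sum_expf_eq0 k_bnd) [RHS](reindex _ (onW_bij _ perm_p)).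
by apply: eq_bigr => c _ /=; rewrite horner_exp.
Qed.

(** * Coefficients of powers of a polynomial of bounded degree *)

Lemma size_exp_le (R : idomainType) (p : {poly R}) (d k : nat) :
  (size p <= d.+1)%N -> (size (p ^+ k) <= (d * k).+1)%N.
Proof.
move=> szp; apply: leq_trans (size_poly_exp_leq _ _) _.
by rewrite ltnS leq_mul2r -subn1 leq_subLR szp orbT.
Qed.

Lemma coef_expr_eq0 (R : idomainType) (p : {poly R}) (d k i : nat) :
  (size p <= d.+1)%N -> (d * k < i)%N -> (p ^+ k)`_i = 0.
Proof.
by move=> szp lt_i; rewrite nth_default // (leq_trans (size_exp_le _ szp)).
Qed.

Lemma coef_expr_top (R : idomainType) (p : {poly R}) (d k : nat) :
  (size p <= d.+1)%N -> (p ^+ k)`_(d * k) = p`_d ^+ k.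
Proof.
move=> szp; elim: k => [|k IHk]; first by rewrite muln0 !expr0 coef1.
rewrite exprS coefM mulnS.
have lt_d : (d < (d + d * k).+1)%N by rewrite ltnS leq_addr.
rewrite (bigD1 (Ordinal lt_d)) //= addKn IHk -exprS big1 ?addr0 // => i.
rewrite -val_eqE /= => i_neq.
(* An index above [d] lies beyond the degree of [p]; one below [d] is paired with a coefficient
   beyond the degree of [p ^+ k]. *)
have [lt_i|] := ltnP i d; last first.
  rewrite leq_eqVlt eq_sym (negPf i_neq) => lt_i.
  by rewrite nth_default ?mul0r ?(leq_trans szp).
rewrite (@coef_expr_eq0 _ _ d) ?mulr0 //.
by rewrite ltn_subRL ltn_add2r.
Qed.

Lemma coef7_neq0 (R : nzRingType) (p : {poly R}) : size p = 8%N -> p`_7 != 0.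
Proof.
move=> szp; rewrite -[7%N]/(8.-1) -szp -lead_coefE lead_coef_eq0.
by rewrite -size_poly_eq0 szp.
Qed.

(** In the binomial expansion only $4Xp^3$ reaches degree $22 = 1 + 3 \cdot 7$. *)
Lemma coef22_sub_expr4 (R : idomainType) (p : {poly R}) :
  (size p <= 8)%N -> (p ^+ 4 - (p - 'X) ^+ 4)`_22 = p`_7 ^+ 3 *+ 4.
Proof.
move=> szp.
have -> : p ^+ 4 - (p - 'X) ^+ 4 =
    'X^1 * p ^+ 3 *+ 4 - 'X^2 * p ^+ 2 *+ 6 + 'X^3 * p ^+ 1 *+ 4 - 'X^4.
  by ring.
rewrite !(coefB, coefD, coefMn, coefXnM, coefXn) /=.
rewrite (@coef_expr_top _ p 7 3) // (@coef_expr_eq0 _ p 7 2) //.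
by rewrite (@coef_expr_eq0 _ p 7 1 19) //; ring.
Qed.

(** Only the terms in $Xp^5$ and $X^2p^4$ reach degree 30, the latter just with its top coefficient,
    as $30 = 2 + 4 \cdot 7$. *)
Lemma coef30_sub_expr6 (R : idomainType) (p : {poly R}) (b : R) :
    (size p <= 8)%N ->
  (p ^+ 6 - (p - b *: 'X) ^+ 6)`_30 =
    b * (p ^+ 5)`_29 *+ 6 - b ^+ 2 * p`_7 ^+ 4 *+ 15.
Proof.
move=> szp.
have -> : p ^+ 6 - (p - b *: 'X) ^+ 6 =
    b *: ('X^1 * p ^+ 5) *+ 6 - b ^+ 2 *: ('X^2 * p ^+ 4) *+ 15
    + b ^+ 3 *: ('X^3 * p ^+ 3) *+ 20 - b ^+ 4 *: ('X^4 * p ^+ 2) *+ 15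
    + b ^+ 5 *: ('X^5 * p ^+ 1) *+ 6 - b ^+ 6 *: 'X^6.
  by rewrite -!mul_polyC !rmorphXn /=; ring.
rewrite !(coefB, coefD) !coefZ !coefXnM coefXn /=.
rewrite (@coef_expr_top _ p 7 4) // (@coef_expr_eq0 _ p 7 3) //.
by rewrite (@coef_expr_eq0 _ p 7 2) // (@coef_expr_eq0 _ p 7 1 25) //; ring.
Qed.

(** * The field with 23 elements *)

Lemma no_orthomorphism_degree7_F23 (f : {poly 'F_23}) :
  size f = 8%N -> ~ orthomorphism_poly f.
Proof.
move=> szf [perm_f perm_g]; set g := f - 'X in perm_g.
have szf_le : (size f <= 8)%N by rewrite szf.
have szg_le : (size g <= 8)%N.
  by rewrite (leq_trans (size_polyD _ _)) // size_polyN size_polyX szf.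
have card23 : (#|'F_23| = 23)%N by rewrite card_Fp.
have coef22 (p : {poly 'F_23}) :
    permutation_poly p -> (size p <= 8)%N -> (p ^+ 4)`_22 = 0.
  move=> perm_p szp.
  apply: (permutation_poly_coef_expr card23) => //.
  (* The degree of [p ^+ 4] is at most $28 < 44 = 2 \cdot 22$. *)
  exact: leq_trans (size_exp_le _ szp) _.
have lead_neq0 := coef7_neq0 szf.
have /eqP := coef22_sub_expr4 szf_le.
rewrite coefB !coef22 // subrr eq_sym -mulr_natr mulf_eq0 expf_eq0 /=.
by rewrite (negPf lead_neq0).
Qed.

(** * Coefficient conditions over the field with 31 elements *)

Lemma septic_expr5 (R : comNzRingType) (r : {poly R}) :
  ('X^7 + r) ^+ 5 =
  r ^+ 5 + 'X^7 * r ^+ 4 *+ 5 + 'X^14 * r ^+ 3 *+ 10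
  + 'X^21 * r ^+ 2 *+ 10 + 'X^28 * r *+ 5 + 'X^35.
Proof. by ring. Qed.

(** The term in $X^{7j} r^{5-j}$ has degree at most $25 + 2j$, and $X^{35}$ is too high, so only $j
    = 3, 4$ contribute. *)
Lemma coef30_septic_expr5 (R : idomainType) (r : {poly R}) :
    (size r <= 6)%N ->
  (('X^7 + r) ^+ 5)`_30 = r`_2 *+ 5 + r`_5 * r`_4 *+ 20.
Proof.
move=> szr; have coefr i : (6 <= i)%N -> r`_i = 0.
  by move=> ge_i; rewrite nth_default ?(leq_trans szr).
rewrite septic_expr5 !(coefD, coefMn, coefXnM, coefXn) /=.
rewrite (@coef_expr_eq0 _ r 5 5) // (@coef_expr_eq0 _ r 5 4) //.
rewrite (@coef_expr_eq0 _ r 5 3) // expr2 coefM !big_ord_recr big_ord0 /=.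
by rewrite subn0 (coefr 9) // (coefr 8) // (coefr 7) // (coefr 6) //; ring.
Qed.

(** One degree lower, $j = 2$ also contributes, through the top coefficient of $r^3$. *)
Lemma coef29_septic_expr5 (R : idomainType) (r : {poly R}) :
    (size r <= 6)%N ->
  (('X^7 + r) ^+ 5)`_29 =
  r`_1 *+ 5 + r`_5 * r`_3 *+ 20 + r`_4 ^+ 2 *+ 10 + r`_5 ^+ 3 *+ 10.
Proof.
move=> szr; have coefr i : (6 <= i)%N -> r`_i = 0.
  by move=> ge_i; rewrite nth_default ?(leq_trans szr).
rewrite septic_expr5 !(coefD, coefMn, coefXnM, coefXn) /=.
rewrite (@coef_expr_top _ r 5 3) // (@coef_expr_eq0 _ r 5 5) //.
rewrite (@coef_expr_eq0 _ r 5 4) // expr2 coefM !big_ord_recr big_ord0 /=.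
by rewrite subn0 (coefr 8) // (coefr 7) // (coefr 6) //; ring.
Qed.

Lemma natr_F31_neq0 n : ~~ (31 %| n)%N -> n%:R != 0 :> 'F_31.
Proof. by rewrite (dvdn_pcharf (pchar_Fp _)). Qed.

(** Hermite's criterion applies up to the sixth power, since $42 < 60$. It gives equations linear in
    [r]_2[and]r[_1], solved by cancelling 5 and $30b$ respectively. *)
Lemma septic_F31_coefs (r : {poly 'F_31}) (b : 'F_31) :
    (size r <= 6)%N -> b != 0 ->
    permutation_poly ('X^7 + r) -> permutation_poly ('X^7 + r - b *: 'X) ->
  r`_2 = - (r`_5 * r`_4 *+ 4) /\
  r`_1 = b / 2%:R - (r`_5 * r`_3 *+ 4 + r`_4 ^+ 2 *+ 2 + r`_5 ^+ 3 *+ 2).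
Proof.
set p := 'X^7 + r; set g := p - _ => szr b_neq0 perm_p perm_g.
have card31 : (#|'F_31| = 31)%N by rewrite card_Fp.
have szp : (size p <= 8)%N.
  by rewrite (leq_trans (size_polyD _ _)) // size_polyXn geq_max (leq_trans szr).
have szg : (size g <= 8)%N.
  rewrite (leq_trans (size_polyD _ _)) // size_polyN geq_max szp /=.
  by rewrite (leq_trans (size_scale_leq _ _)) // size_polyX.
have coef30 k (h : {poly 'F_31}) :
    permutation_poly h -> (size h <= 8)%N -> (0 < k <= 6)%N -> (h ^+ k)`_30 = 0.
  move=> perm_h szh /andP[k_gt0 le_k].
  apply: (permutation_poly_coef_expr card31) => //.
    by rewrite k_gt0 (leq_ltn_trans le_k).
  by rewrite (leq_trans (size_exp_le _ szh)) //
    (@leq_trans (7 * 6).+1) // ltnS leq_mul2l.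
have coef7 : p`_7 = 1 by rewrite coefD coefXn /= nth_default ?addr0 ?(leq_trans szr).
have e5 := coef30 5%N _ perm_p szp isT.
rewrite coef30_septic_expr5 // in e5.
have := coef30_sub_expr6 b szp; rewrite coefB !coef30 // subrr.
rewrite coef29_septic_expr5 // coef7 expr1n => e6.
have n5 : 5%:R != 0 :> 'F_31 by exact: natr_F31_neq0.
have n2 : 2%:R != 0 :> 'F_31 by exact: natr_F31_neq0.
have n30 : 30%:R != 0 :> 'F_31 by exact: natr_F31_neq0.
split.
  apply/eqP; rewrite -subr_eq0 opprK; apply/eqP/(mulfI n5).
  by rewrite mulr0 -[RHS]e5; ring.
apply/eqP; rewrite -subr_eq0; apply/eqP/(mulfI n30)/(mulfI b_neq0).
by rewrite !mulr0 [RHS]e6; field.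
Qed.

(** * Affine normalisation in degree 7 *)

Lemma permutation_poly_affine (F : finFieldType) (p q : {poly F}) (k u s c : F) :
    k != 0 -> u != 0 -> permutation_poly p ->
  (forall x, q.[x] = k * p.[u * x + s] + c) -> permutation_poly q.
Proof.
move=> k_neq0 u_neq0 perm_p qE; apply: injF_bij => x y; rewrite !qE.
by move=> /addIr/(mulfI k_neq0)/(bij_inj perm_p)/addIr/(mulfI u_neq0).
Qed.

(** The shift [s] removes the term of degree 6 and the outer factor makes the result monic; [u]
    stays free to change the coefficient of degree 5 by a square. *)
Lemma septic_normal_form (K : fieldType) (f : {poly K}) (u : K) :
    size f = 8%N -> 7%:R != 0 :> K -> u != 0 ->
  exists r : {poly K}, [/\ (size r <= 6)%N,
    r`_5 = (f`_5 / f`_7 - 3%:R / 7%:R * (f`_6 / f`_7) ^+ 2) / u ^+ 2 &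
    forall x, ('X^7 + r).[x] =
      (f`_7 * u ^+ 7)^-1 * f.[u * x + - f`_6 / (7%:R * f`_7)]].
Proof.
move=> szf n7 u_neq0; set s := - _ / _.
have a_neq0 := coef7_neq0 szf.
(* The Hasse derivatives at [s] are the Taylor coefficients of [f] there, without division by
   factorials. *)
have nderivnE i n : (8 <= n + i)%N ->
    f^`N(i).[s] = \sum_(j < n) f`_(i + j) *+ 'C(i + j, i) * s ^+ j.
  move=> le8; rewrite (@horner_coef_wide _ n) => [|].
    by apply: eq_bigr => j _; rewrite coef_nderivn.
  apply/leq_sizeP => j le_j; rewrite coef_nderivn nth_default ?mul0rn // szf.
  by rewrite (leq_trans le8) // addnC leq_add2l.
have D7 : f^`N(7).[s] = f`_7.
  by rewrite (nderivnE 7%N 1%N) // big_ord1 expr0 mulr1 addn0 binn.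
have D6 : f^`N(6).[s] = 0.
  rewrite (nderivnE 6%N 2%N) // !big_ord_recr big_ord0 /= binSn binn /s.
  by field; rewrite a_neq0 n7.
have D5 : f^`N(5).[s] / f`_7 =
    f`_5 / f`_7 - 3%:R / 7%:R * (f`_6 / f`_7) ^+ 2.
  rewrite (nderivnE 5%N 3%N) // !big_ord_recr big_ord0 /= binn binSn /s.
  rewrite (_ : 'C(5 + 2, 5) = 21%N) //.
  by field; rewrite a_neq0 n7.
exists (\poly_(i < 6) (f^`N(i).[s] * u ^+ i / (f`_7 * u ^+ 7))).
split=> [||x]; first exact: size_poly.
  by rewrite coef_poly /= -D5; field; rewrite a_neq0 u_neq0.
have -> : f.[u * x + s] =
    \sum_(i < 6) f^`N(i).[s] * (u * x) ^+ i + f`_7 * (u * x) ^+ 7.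
  rewrite addrC nderiv_taylor; last exact: mulrC.
  by rewrite szf 2!big_ord_recr /= D6 D7 mul0r addr0.
rewrite hornerD hornerXn horner_poly mulrDr mulr_sumr addrC; congr (_ + _).
  by apply: eq_bigr => i _; rewrite exprMn; ring.
by field; rewrite a_neq0 u_neq0.
Qed.

(** * Exhaustive search modulo 31 and its transfer to the field *)

Definition residues : seq N := [seq N.of_nat i | i <- iota 0 31].

(* With [a2] and [a1 - b / 2] as forced by [septic_F31_coefs]; 27 and 29 stand
   for -4 and -2 modulo 31. *)
Definition septic (a5 a4 a3 x : N) : N := N.modulo
  (x * (x * (x * (x * (x * (x * x + a5) + a4) + a3) + 27 * a5 * a4)
    + (27 * a5 * a3 + 29 * (a4 * a4 + a5 * a5 * a5))))%num 31.

(* [seen] is the bit mask of the values already met; [if] replaces [||], which is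
   strict under [vm_compute]. *)
Fixpoint repeats (T : Type) (f : T -> N) (seen : N) (s : seq T) : bool :=
  if s is x :: s' then
    let y := f x in
    if N.testbit seen y then true
    else repeats f (N.setbit seen y) s'
  else false.

(** Adds the linear term to an entry $(x, h(x))$ of a table that is built once and shared by all
    [e]. *)
Definition shift (e : N) (p : N * N) : N :=
  N.modulo (p.2 + e * p.1)%num 31.

Definition no_septic_pair (a5 : N) : bool :=
  all (fun a4 => all (fun a3 =>
    let t := [seq (x, septic a5 a4 a3 x) | x <- residues] in
    all (fun e => if repeats (shift e) 0 t then true
                  else repeats (shift (N.sub 31 e)) 0 t)
      (behead residues)) residues) residues.

Lemma no_septic_pair_check : all no_septic_pair [:: 0; 1; 3]%num.
Proof. by vm_compute. Qed.

Lemma repeatsP (T : Type) (f : T -> N) (s : seq T) :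
  repeats f 0%num s -> ~~ uniq (map f s).
Proof.
(* For the induction the mask is arbitrary: a hit is a repetition inside the list or a value already
   in the mask. *)
suff gen seen : repeats f seen s ->
    ~~ uniq (map f s) || has (N.testbit seen) (map f s).
  move=> /gen; case/orP=> // /hasP[y _]; by rewrite N.bits_0.
elim: s seen => //= x s IHs seen; case: ifP => [_ _|_ /IHs] /=.
  by rewrite orbT.
case/orP=> [/negPf ->|/hasP[y y_in]]; first by rewrite andbF.
rewrite N.setbit_eqb => /orP[/N.eqb_eq ->|seen_y]; first by rewrite y_in.
by apply/orP; right; apply/hasP; exists y.
Qed.

Definition F31 (n : N) : 'F_31 := (N.to_nat n)%:R.

Lemma F31D m n : F31 (m + n)%num = F31 m + F31 n.
Proof. by rewrite /F31 N2Nat.inj_add plusE natrD. Qed.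

Lemma F31M m n : F31 (m * n)%num = F31 m * F31 n.
Proof. by rewrite /F31 N2Nat.inj_mul multE natrM. Qed.

Lemma F31_31 : F31 31 = 0.
Proof. by apply/val_inj. Qed.

Lemma F31_mod n : F31 (N.modulo n 31) = F31 n.
Proof.
by rewrite [in RHS](N.Div0.div_mod n 31) F31D F31M F31_31 mul0r add0r.
Qed.

Lemma F31_onto (x : 'F_31) : exists2 n, n \in residues & F31 n = x.
Proof.
exists (N.of_nat x); last by rewrite /F31 Nat2N.id natr_Zp.
by rewrite map_f // mem_iota ltn_ord.
Qed.

Lemma uniq_F31_residues : uniq (map F31 residues).
Proof. by vm_compute. Qed.

(** Under [F31] the list becomes the values of the injective [h] at 31 distinct points, and a list
    whose image has no duplicates has none itself. *)
Lemma no_repeats (h : 'F_31 -> 'F_31) (f : N -> N) (T : Type) (g : T -> N)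
    (s : seq T) :
  injective h -> map g s = map (fun x => N.modulo (f x) 31) residues ->
  (forall x, F31 (f x) = h (F31 x)) -> uniq (map g s).
Proof.
move=> h_inj -> fE; apply: (@map_uniq _ _ F31).
rewrite -map_comp (eq_map (_ : _ =1 h \o F31)).
  by rewrite map_comp map_inj_uniq // uniq_F31_residues.
by move=> x /=; rewrite F31_mod fE.
Qed.

Lemma no_septic_pair_F31 (a5 a4 a3 e : 'F_31) :
    a5 \in [:: 0; 1; 3%:R] -> e != 0 ->
  let h x := x ^+ 7 + a5 * x ^+ 5 + a4 * x ^+ 4 + a3 * x ^+ 3
    - a5 * a4 *+ 4 * x ^+ 2
    - (a5 * a3 *+ 4 + a4 ^+ 2 *+ 2 + a5 ^+ 3 *+ 2) * x in
  injective (fun x => h x + e * x) -> injective (fun x => h x - e * x) -> False.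
Proof.
move=> a5_in e_neq0 h inj_p inj_m.
have [n5 n5_in n5E] : exists2 n, n \in [:: 0; 1; 3]%num & F31 n = a5.
  by move: a5_in; rewrite !inE => /or3P[] /eqP ->;
    [exists 0%num | exists 1%num | exists 3%num]=> //; apply/val_inj.
have [n4 n4_in n4E] := F31_onto a4; have [n3 n3_in n3E] := F31_onto a3.
have [ne ne_in neE] := F31_onto e.
have ne_in' : ne \in behead residues.
  move: ne_in e_neq0; rewrite inE => /orP[/eqP ne0|//] /negP[].
  by rewrite -neE ne0.
(* Subtraction in [N] is truncated; this bound makes [N.sub 31 ne] represent [- e]. *)
have le_ne : (ne <= 31)%num.
  by apply/N.leb_le; apply: (allP (a := fun n => N.leb n 31) _ _ ne_in').
have septicE x : F31 (septic n5 n4 n3 x) = h (F31 x).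
  rewrite /septic F31_mod !(F31D, F31M) n5E n4E n3E /h.
  rewrite (_ : F31 27 = - 4%:R); last exact/val_inj.
  rewrite (_ : F31 29 = - 2%:R); last exact/val_inj.
  ring.
have FeN : F31 (N.sub 31 ne) = - e.
  apply/eqP; rewrite -addr_eq0 -neE -F31D N.sub_add //; exact/eqP/F31_31.
have no_rep d (k : 'F_31) : F31 d = k -> injective (fun x => h x + k * x) ->
    repeats (shift d) 0 [seq (x, septic n5 n4 n3 x) | x <- residues] = false.
  move=> dE inj_k; apply/negP => /repeatsP/negP; apply.
  apply: (no_repeats (f := fun x => (septic n5 n4 n3 x + d * x)%num) inj_k).
    by rewrite -map_comp.
  by move=> x; rewrite F31D F31M septicE dE.
have /allP/(_ n5 n5_in)/allP/(_ n4 n4_in)/allP/(_ n3 n3_in)/allP/(_ ne ne_in')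
  := no_septic_pair_check.
by rewrite (no_rep _ _ neE) // (no_rep _ _ FeN) // => x y; rewrite !mulNr => /inj_m.
Qed.

(** * Square classes and the conclusion for 31 elements *)

(** The nonzero squares have index 2 and 3 is not one of them; the resulting three cases are
    verified residue by residue. *)
Lemma F31_square_class (a : 'F_31) :
  exists2 u : 'F_31, u != 0 & a / u ^+ 2 \in [:: 0; 1; 3%:R].
Proof.
suff [u u_neq0] : exists2 u : 'F_31, u != 0 & a \in [:: 0; u ^+ 2; 3%:R * u ^+ 2].
  rewrite !inE => a_in; exists u => //; rewrite !inE.
  have u2 : u ^+ 2 != 0 by rewrite expf_neq0.
  case/or3P: a_in => /eqP ->; first by rewrite mul0r eqxx.
    by rewrite divff // eqxx orbT.
  by rewrite mulfK // eqxx !orbT.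
have : all (fun n => has (fun m => let u := F31 m in
    F31 n \in [:: 0; u ^+ 2; 3%:R * u ^+ 2]) (behead residues)) residues.
  by vm_compute.
have [n n_in <-] := F31_onto a.
move=> /allP/(_ n n_in)/hasP[m m_in mP]; exists (F31 m) => //.
by apply: (allP (a := fun m => F31 m != 0) _ m m_in); vm_compute.
Qed.

Lemma no_orthomorphism_degree7_F31 (f : {poly 'F_31}) :
  size f = 8%N -> ~ orthomorphism_poly f.
Proof.
move=> szf [perm_f perm_g].
have [u u_neq0 u_class] :=
  F31_square_class (f`_5 / f`_7 - 3%:R / 7%:R * (f`_6 / f`_7) ^+ 2).
have n7 : 7%:R != 0 :> 'F_31 by exact: natr_F31_neq0.
have n2 : 2%:R != 0 :> 'F_31 by exact: natr_F31_neq0.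
have [r [szr r5 rE]] := septic_normal_form szf n7 u_neq0.
set k := (_ * _)^-1 in rE; set s := - _ / _ in rE.
have a_neq0 := coef7_neq0 szf.
have k_neq0 : k != 0 by rewrite invr_neq0 // mulf_neq0 // expf_neq0.
have perm_p : permutation_poly ('X^7 + r).
  apply: (permutation_poly_affine (s := s) (c := 0) k_neq0 u_neq0 perm_f) => x.
  by rewrite addr0.
pose b := k * u; have b_neq0 : b != 0 by rewrite mulf_neq0.
(* The same substitution in [f - 'X] subtracts $k(ux+s) = bx + ks$; the constant $ks$ is added
   back. *)
have perm_q : permutation_poly ('X^7 + r - b *: 'X).
  apply: (permutation_poly_affine (s := s) (c := k * s) k_neq0 u_neq0 perm_g) => x.
  have -> : ('X^7 + r - b *: 'X).[x] = ('X^7 + r).[x] - b * x.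
    by rewrite hornerD hornerN hornerZ hornerX.
  by rewrite rE !(hornerD, hornerN, hornerX) /b; ring.
have [r2 r1] := septic_F31_coefs szr b_neq0 perm_p perm_q.
rewrite -r5 in u_class.
have e_neq0 : b / 2%:R != 0 by rewrite mulf_neq0 // invr_neq0.
have rX x : r.[x] = r`_5 * x ^+ 5 + r`_4 * x ^+ 4 + r`_3 * x ^+ 3
    + r`_2 * x ^+ 2 + r`_1 * x + r`_0.
  by rewrite (horner_coef_wide _ szr) !big_ord_recr big_ord0 /=; ring.
apply: (@no_septic_pair_F31 _ r`_4 r`_3 _ u_class e_neq0) => x y /= hxy.
  apply: (bij_inj perm_p); rewrite !(hornerD, hornerXn) !rX r1 r2.
  apply: etrans (etrans (congr1 (+%R^~ r`_0) hxy) _); ring.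
apply: (bij_inj perm_q).
rewrite !(hornerD, hornerN, hornerZ, hornerX, hornerXn) !rX r1 r2.
by apply: etrans (etrans (congr1 (+%R^~ r`_0) hxy) _); field.
Qed.

(* [size f = 8] means that f has degree 7. *)
Theorem theorem3p3 :
  (~ exists f : {poly 'F_23}, size f = 8%N /\ orthomorphism_poly f) /\
  (~ exists f : {poly 'F_31}, size f = 8%N /\ orthomorphism_poly f).
Proof.
by split=> -[f [szf]];
  [apply: no_orthomorphism_degree7_F23 | apply: no_orthomorphism_degree7_F31].
Qed.
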